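(* Let $\phi\colon\mathbb{R}\to\mathbb{R}$ be a continuous piecewise linear strongly maximal general dual-feasible function (gDFF) with only 2 slope values. Then $\phi$ is extreme.
   Context: A function $\phi\colon\mathbb{R}\to\mathbb{R}$ is a (valid) general dual-feasible function (gDFF) if for every finite family $(x_i)_{i\in I}$ of real numbers (repetitions allowed), $\sum_{i\in I}x_i\le 1$ implies $\sum_{i\in I}\phi(x_i)\le 1$. A gDFF $\phi$ is implied by a gDFF $\phi_1$ if there are $0\le\alpha,\beta\le 1$ with $\alpha+\beta\le 1$ such that $\phi(x)\le\beta\phi_1(x)+\alpha x$ for all $x\in\mathbb{R}$; $\phi$ is strongly maximal if it is not implied by any gDFF $\phi_1\ne\phi$. A gDFF is extreme if it cannot be written as a convex combination of two other different gDFFs; equivalently, whenever $\phi=\frac12(\phi_1+\phi_2)$ with gDFFs $\phi_1,\phi_2$, then $\phi_1=\phi_2=\phi$. A function $\mathbb{R}\to\mathbb{R}$ is piecewise linear if there is a locally finite set of breakpoints in $\mathbb{R}$ such that the function is affine on each open interval of the complement of this set; its slope values are the slopes of these affine pieces. *)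

(* Defs.v *)
From mathcomp Require Import all_boot all_order all_algebra.
From mathcomp Require Import all_classical all_reals all_analysis.

Set Implicit Arguments.
Unset Strict Implicit.
Unset Printing Implicit Defensive.

Import Order.TTheory GRing.Theory Num.Theory.
Import numFieldNormedType.Exports.

Local Open Scope classical_set_scope.
Local Open Scope ring_scope.

(* A finite family is a function on a finite type, so values may repeat. *)
Definition gDFF (R : realType) (phi : R -> R) : Prop :=
  forall (I : finType) (x : I -> R),
    \sum_(i : I) x i <= 1 -> \sum_(i : I) phi (x i) <= 1.

Definition implied_by (R : realType) (phi phi1 : R -> R) : Prop :=
  exists alpha beta : R,
    [/\ 0 <= alpha <= 1, 0 <= beta <= 1, alpha + beta <= 1 &
        forall x : R, phi x <= beta * phi1 x + alpha * x].

Definition strongly_maximal (R : realType) (phi : R -> R) : Prop :=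
  gDFF phi /\
  forall phi1 : R -> R, gDFF phi1 -> phi1 <> phi -> ~ implied_by phi phi1.

Definition extreme (R : realType) (phi : R -> R) : Prop :=
  gDFF phi /\
  ~ exists (phi1 phi2 : R -> R) (t : R),
      [/\ gDFF phi1 /\ gDFF phi2,
          [/\ phi1 <> phi, phi2 <> phi & phi1 <> phi2],
          0 <= t <= 1 &
          forall x : R, phi x = t * phi1 x + (1 - t) * phi2 x].

Definition locally_finite_set (R : realType) (B : set R) : Prop :=
  forall x : R, exists2 U : set R, nbhs x U & finite_set (U `&` B).

(* When B is locally finite it is closed, so the connected components of its
   complement are exactly the maximal open intervals avoiding B. *)
Definition pieces (R : realType) (B : set R) : set (set R) :=
  [set C | exists2 x : R, ~ B x & C = connected_component (~` B) x].

Definition affine_with_slope (R : realType) (phi : R -> R) (C : set R) (m : R)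
    : Prop :=
  exists c : R, forall x : R, C x -> phi x = m * x + c.

Definition piecewise_linear_on (R : realType) (phi : R -> R) (B : set R)
    : Prop :=
  locally_finite_set B /\
  forall C : set R, pieces B C -> exists m : R, affine_with_slope phi C m.

(* The value does not depend on the choice of B among the sets satisfying
   [piecewise_linear_on phi B]. *)
Definition slope_values (R : realType) (phi : R -> R) (B : set R) : set R :=
  [set m | exists2 C : set R, pieces B C & affine_with_slope phi C m].

(* Main.v *)
Require Import Defs.
From mathcomp Require Import all_boot all_order all_algebra.
From mathcomp Require Import all_classical all_reals all_analysis.
From mathcomp Require Import ring lra.
Import Order.TTheory GRing.Theory Num.Theory.
Import numFieldNormedType.Exports.
Local Open Scope classical_set_scope.
Local Open Scope ring_scope.

(** Why the theorem holds.

    A strongly maximal [phi] is in particular not dominated pointwise by another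
    dual-feasible function.  Raising the value of an undominated [f] at one
    point [x] to [\sum f x_i], for a family with [\sum x_i <= x], keeps it
    dual feasible; hence [f] already satisfies [\sum f x_i <= f x]
    ([undominated_sum]).  So [f] is superadditive, nondecreasing and vanishes
    at 0.  If [phi = t phi1 + (1 - t) phi2] is a proper convex combination,
    anything dominating [phi1] would give a function dominating [phi]; so
    [phi1] and [phi2] are undominated too ([undominated_summand]), and every
    equality [phi x + phi y = phi (x + y)] is inherited by both.

    Superadditivity makes the slope of [phi] just right of 0 the least slope
    and the slope just left of 0 the greatest ([slope_bounds]).  The remaining
    strength of strong maximality is used to get [phi 1 = 1] (otherwise [phi]
    can be scaled up) and to see that the least slope is 0 (otherwise a linear
    function can be subtracted).  So the two slopes are 0, to the right of 0,
    and some [s > 0], to the left of 0.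

    On a piece of slope 0, [phi] is constant, and the nondecreasing [phi1] and
    [phi2] must be constant as well.  On a piece of slope [s], a short backward
    step is additive, [phi (y - h) = phi y + phi (- h)], hence
    [phi1 (y - h) = phi1 y + phi1 (- h)]; and [phi1 (- h)] is linear in small
    [h >= 0], being additive and monotone.  Thus on all pieces the increments
    of [phi1] are the same multiple [k] of those of [phi], and
    [phi1 = k phi] ([summand_proportional]).  Both functions are 1 at 1, so
    [k = 1] and [phi1 = phi]. *)

(** * Dual-feasible functions that no other one dominates *)

Definition superadditive {R : realType} (f : R -> R) : Prop :=
  forall x y, f x + f y <= f (x + y).

Definition undominated {R : realType} (f : R -> R) : Prop :=
  gDFF f /\ forall g, gDFF g -> (forall x, f x <= g x) -> g = f.

(** Sequences replace finite types as index sets because concatenating and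
    flattening them is immediate. *)
Lemma gDFF_seqP {R : realType} (f : R -> R) :
  gDFF f <->
  forall s : seq R, \sum_(y <- s) y <= 1 -> \sum_(y <- s) f y <= 1.
Proof.
split=> [fD s|fs I x].
  rewrite big_tnth [X in _ -> X <= 1]big_tnth; exact: fD.
by have := fs [seq x i | i <- index_enum I]; rewrite !big_map.
Qed.

Lemma gDFF_at1 {R : realType} {f : R -> R} : gDFF f -> f 1 <= 1.
Proof.
by move=> /(_ unit (fun=> 1)); rewrite !big_const card_unit /= !addr0; apply.
Qed.

(** In a family with sum at most 1, each entry [x] may be replaced by a family
    whose sum is at most [x], and the new total is still at most 1. *)
Lemma gDFF_substitution {R : realType} (f g : R -> R) : gDFF f ->
  (forall x, exists s : seq R,
     \sum_(y <- s) y <= x /\ g x <= \sum_(y <- s) f y) ->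
  gDFF g.
Proof.
move=> /gDFF_seqP fD /choice[F FP]; apply/gDFF_seqP => s s1.
have := fD (flatten [seq F y | y <- s]).
rewrite !big_flatten !big_map => h.
apply: (@le_trans _ _ (\sum_(j <- s) \sum_(i <- F j) f i)).
  by apply: ler_sum => i _; have [] := FP i.
apply: h; apply: le_trans s1.
by apply: ler_sum => i _; have [] := FP i.
Qed.

(** Superadditivity collapses a family to its sum; this is how all competitors
    of a strongly maximal function are checked to be dual feasible. *)
Lemma superadditive_gDFF {R : realType} (f : R -> R) :
  superadditive f -> {homo f : x y / x <= y} -> 0 <= f 0 -> f 1 <= 1 ->
  gDFF f.
Proof.
move=> fD fle f0 f1; apply/gDFF_seqP => s s1.
apply: (@le_trans _ _ (f (\sum_(y <- s) y))); last first.
  exact: le_trans (fle _ _ s1) f1.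
elim: s {s1} => [|y s ih]; first by rewrite !big_nil.
by rewrite !big_cons (le_trans _ (fD _ _))// lerD2l.
Qed.

Lemma superadditive_natmul {R : realType} (f : R -> R) (n : nat) (u : R) :
  superadditive f -> f 0 = 0 -> n%:R * f u <= f (n%:R * u).
Proof.
move=> fD f0; elim: n => [|n ih]; first by rewrite !mul0r f0.
by rewrite -natr1 !mulrDl !mul1r (le_trans _ (fD _ _))// lerD2r.
Qed.

(** Otherwise [f], modified at the single point [x] to take the larger value
    [\sum_(y <- s) f y], would be dual feasible by substitution and would
    dominate [f]. *)
Lemma undominated_sum {R : realType} (f : R -> R) (s : seq R) (x : R) :
  undominated f -> \sum_(y <- s) y <= x -> \sum_(y <- s) f y <= f x.
Proof.
move=> [fD fmax] sx; rewrite leNgt; apply/negP => lt.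
pose g z := if z == x then \sum_(y <- s) f y else f z.
have gf : g = f.
  apply: fmax => [|z].
    apply: (@gDFF_substitution _ f) => // z.
    rewrite /g; case: eqVneq => [->|_]; first by exists s.
    by exists [:: z]; rewrite !big_seq1.
  by rewrite /g; case: eqVneq => // ->; apply: ltW.
by move: lt; rewrite -{1}gf /g eqxx ltxx.
Qed.

(** Three instances of [undominated_sum]: a pair, a singleton, and the empty
    family. *)
Lemma undominated_shape {R : realType} {f : R -> R} : undominated f ->
  [/\ superadditive f, {homo f : x y / x <= y} & f 0 = 0].
Proof.
move=> fmax; have sumle := fun s x => @undominated_sum R f s x fmax.
have fD : superadditive f.
  move=> x y; have := sumle [:: x; y] (x + y).
  by rewrite !big_cons !big_nil !addr0; apply.
split=> // [x y xy|].
  by have := sumle [:: x] y; rewrite !big_seq1; apply.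
have := sumle [::] 0; rewrite !big_nil => /(_ (lexx _)).
by have := fD 0 0; rewrite addr0; lra.
Qed.

(** A function dominating [f1] can be put in its place in the convex
    combination, which then dominates [f]. *)
Lemma undominated_summand {R : realType} {f f1 f2 : R -> R} {t : R} :
  undominated f -> gDFF f1 -> gDFF f2 -> 0 < t < 1 ->
  (forall x, f x = t * f1 x + (1 - t) * f2 x) -> undominated f1.
Proof.
move=> [_ fmax] f1D f2D /andP[t0 t1] fE; split=> // g gD f1g.
pose h x := t * g x + (1 - t) * f2 x.
have hf : h = f.
  apply: fmax => [I x x1|x]; last first.
    by rewrite fE /h lerD2r ler_pM2l.
  rewrite /h big_split/= -!mulr_sumr.
  have := gD I x x1; have := f2D I x x1; nra.
apply/funext => x; have := congr1 (@^~ x) hf; rewrite /h fE /=.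
by move=> /addIr /mulfI; apply; rewrite gt_eqF.
Qed.

(** Domination is implication with [alpha = 0] and [beta = 1]. *)
Lemma strongly_maximal_undominated {R : realType} {f : R -> R} :
  strongly_maximal f -> undominated f.
Proof.
move=> [fD fmax]; split=> // g gD fg; apply: contrapT => /(fmax g gD); apply.
exists 0, 1; split; rewrite ?lexx ?ler01 ?add0r// => x.
by rewrite mul1r mul0r addr0.
Qed.

(** If [f 1 <= b < 1], then [b^-1 f] is still dual feasible and implies [f].
    This contradicts strong maximality unless [b^-1 f = f], i.e. [f = 0]; and
    the zero function is implied by any other one. *)
Lemma strongly_maximal_at1 {R : realType} {f : R -> R} :
  strongly_maximal f -> f 1 = 1.
Proof.
move=> fmax.
have [fD fle f0] := undominated_shape (strongly_maximal_undominated fmax).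
case: fmax => fG fmax.
have f1 := gDFF_at1 fG.
have f1_ge0 : 0 <= f 1 by rewrite -f0 fle.
apply: contrapT => /eqP f1n1.
have [b [b0 b1 bf1]] : exists b : R, [/\ 0 < b, b < 1 & f 1 <= b].
  exists ((f 1 + 1) / 2); split; lra.
pose g x := b^-1 * f x.
have gD : gDFF g.
  apply: superadditive_gDFF => [x y|x y xy||].
  - by rewrite /g -mulrDr ler_pM2l ?invr_gt0.
  - by rewrite /g ler_pM2l ?invr_gt0// fle.
  - by rewrite /g f0 mulr0.
  - by rewrite /g ler_pdivrMl// mulr1.
have fg x : f x = b * g x by rewrite /g mulrA divff ?mul1r// gt_eqF.
have gf : g = f.
  apply: contrapT => /(fmax g gD); apply.
  exists 0, b; split; rewrite ?lexx ?ler01 ?add0r ?(ltW b0) ?(ltW b1)// => x.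
  by rewrite mul0r addr0 -fg.
have fz x : f x = 0.
  have := fg x; rewrite gf => h.
  have : (1 - b) * f x = 0 by rewrite mulrBl mul1r -h subrr.
  by move/eqP; rewrite mulf_eq0 subr_eq0 gt_eqF//= => /eqP.
have idD : gDFF (fun x : R => x) by [].
apply: (fmax _ idD).
  by move=> /(congr1 (@^~ 1)) /=; rewrite fz => /eqP; rewrite oner_eq0.
exists 0, 0; split; rewrite ?lexx ?ler01 ?add0r// => x.
by rewrite fz !mul0r addr0.
Qed.

(** With [k = m / 2], the function [f - k x] is still superadditive and
    nondecreasing, and rescaled by [(1 - k)^-1] it is dual feasible and implies
    [f].  By strong maximality it equals [f], so [f] is the identity, which is
    implied by every dual-feasible function (take [alpha = 1]). *)
Lemma strongly_maximal_no_linear_minorant {R : realType} {f : R -> R} {m : R} :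
  strongly_maximal f -> 0 < m -> (forall h, 0 <= h -> m * h <= f h) -> False.
Proof.
move=> fmax m0 mf; have f1 := strongly_maximal_at1 fmax.
have [fD fle f0] := undominated_shape (strongly_maximal_undominated fmax).
case: fmax => fG fmax.
have m1 : m <= 1 by have := mf 1 ler01; rewrite f1; lra.
(* Halving [m] keeps [1 - k] away from 0 even when [m = 1]. *)
pose k := m / 2; pose c := (1 - k)^-1.
have k1 : 0 < 1 - k by rewrite /k; lra.
have c0 : 0 < c by rewrite invr_gt0.
have ck : c * (1 - k) = 1 by rewrite mulVf// gt_eqF.
pose g x := c * (f x - k * x).
have gD : gDFF g.
  apply: superadditive_gDFF => [x y|x y xy||].
  - by rewrite /g -mulrDr ler_pM2l//; have := fD x y; lra.
  - rewrite /g ler_pM2l//.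
    have := fD x (y - x); rewrite subrKC; have := mf (y - x).
    rewrite subr_ge0 => /(_ xy); rewrite /k; nra.
  - by rewrite /g f0 mulr0 subr0 mulr0.
  - by rewrite /g f1 mulr1 ck.
have fg x : f x = (1 - k) * g x + k * x.
  by rewrite /g mulrA [_ * c]mulrC ck mul1r subrK.
have k01 : 0 <= k <= 1 by rewrite /k; lra.
have gf : g = f.
  apply: contrapT => /(fmax g gD); apply.
  exists k, (1 - k); split; [by []|lra|lra|by move=> x; rewrite -fg].
have fid x : f x = x.
  have := fg x; rewrite gf => h.
  have : k * (f x - x) = 0 by lra.
  by move/eqP; rewrite mulf_eq0 subr_eq0 gt_eqF ?divr_gt0//= => /eqP.
have zD : gDFF (fun _ : R => 0).
  by move=> I x _; rewrite big1.
apply: (fmax _ zD).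
  by move=> /(congr1 (@^~ 1)) /=; rewrite fid => /eqP; rewrite eq_sym oner_eq0.
exists 1, 0; split; rewrite ?lexx ?ler01 ?addr0// => x.
by rewrite fid mul0r add0r mul1r.
Qed.

(** * Affine pieces and slopes *)

(** Cauchy's equation on an interval.  Measuring [h] in units [e / N] leaves a
    remainder [r] smaller than one unit, so monotonicity bounds the error by
    [f (e / N) = f e / N], for every [N]. *)
Lemma monotone_additive_linear {R : realType} (f : R -> R) (e : R) :
  0 < e -> {in `[0, e] &, {homo f : x y / x <= y}} ->
  (forall x y, 0 <= x -> 0 <= y -> x + y <= e -> f (x + y) = f x + f y) ->
  forall h, 0 <= h <= e -> f h = f e / e * h.
Proof.
move=> e0 fle fD h /andP[h0 he].
have f0 : f 0 = 0.
  by have := fD 0 0 (lexx _) (lexx _); rewrite addr0 => /(_ (ltW e0)); lra.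
have fM (n : nat) (u : R) :
    0 <= u -> n%:R * u <= e -> f (n%:R * u) = n%:R * f u.
  move=> u0; elim: n => [|n ih] nu; first by rewrite !mul0r f0.
  have n0 : 0 <= n%:R * u by rewrite mulr_ge0.
  rewrite -natr1 mulrDl mul1r in nu *.
  by rewrite fD // ih; [rewrite mulrDl mul1r|lra].
have fe0 : 0 <= f e.
  by rewrite -f0; apply: fle; rewrite ?in_itv/= ?lexx ?ltW.
have close (n : nat) : `|f h - f e / e * h| <= f e * n.+1%:R^-1.
  pose N : R := n.+1%:R; have N0 : 0 < N by rewrite ltr0n.
  pose u := e / N; have u0 : 0 < u by rewrite divr_gt0.
  have Nu : N * u = e by rewrite /u mulrCA divff ?mulr1// gt_eqF.
  have feN : f e = N * f u by rewrite -{1}Nu fM ?Nu// ltW.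
  have ue : u <= e by rewrite ler_pdivrMr// ler_peMr ?ler1n// ltW.
  have fu0 : 0 <= f u.
    by rewrite -f0; apply: fle; rewrite ?in_itv/= ?lexx ?(ltW u0) ?(ltW e0).
  pose k : R := (Num.truncn (h / u))%:R; pose r := h - k * u.
  have /andP[kh hk] := truncn_itv (divr_ge0 h0 (ltW u0)).
  rewrite -natr1 -/k in hk.
  have kq := kh; rewrite -/k ler_pdivlMr// in kh.
  have r0 : 0 <= r by rewrite subr_ge0.
  have ru : r < u by rewrite ltrBlDl -[X in _ + X]mul1r -mulrDl -ltr_pdivrMr.
  have ku0 : 0 <= k * u by rewrite mulr_ge0// ltW.
  have fh : f h = k * f u + f r.
    have hE : k * u + r = h by rewrite /r subrKC.
    by rewrite -[in LHS]hE fD ?hE// fM ?(ltW u0)// (le_trans kh).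
  have fr : 0 <= f r <= f u.
    by rewrite -{1}f0 !fle ?in_itv/= ?lexx//; lra.
  have -> : f e / e * h = f u * (h / u).
    by rewrite feN /u; field; rewrite !gt_eqF.
  have -> : f e * N^-1 = f u by rewrite feN; field; rewrite gt_eqF.
  have /andP[fr0 fr1] := fr.
  have fq0 : 0 <= f u * (h / u - k) by rewrite mulr_ge0// subr_ge0.
  have fq1 : f u * (h / u - k) <= f u by rewrite ler_piMr//; lra.
  by rewrite fh ler_norml; apply/andP; split; lra.
apply/eqP; rewrite -subr_eq0 -normr_eq0 eq_le normr_ge0 andbT.
rewrite leNgt; apply/negP => d0.
have fe_gt0 : 0 < f e.
  rewrite lt_neqAle fe0 andbT; apply/negP => /eqP fe.
  by have := lt_le_trans d0 (close 0%N); rewrite -fe mul0r ltxx.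
have [n] := ltr_add_invr (divr_gt0 d0 fe_gt0).
rewrite add0r ltr_pdivlMr// mulrC ltNge close //.
Qed.

(** Slopes are recorded by increments over closed intervals: this drops the
    intercept and lets adjacent pieces share their endpoint. *)
Definition affine_on {R : realType} (f : R -> R) (a b m : R) : Prop :=
  forall x y, a <= x <= b -> a <= y <= b -> f y - f x = m * (y - x).

(** Continuity carries an affine formula to the two endpoints. *)
Lemma affine_on_open {R : realType} (f : R -> R) (a b m : R) :
  continuous f -> a < b -> affine_with_slope f `]a, b[ m -> affine_on f a b m.
Proof.
move=> fc ab [c fE].
pose g y := f y - m * y.
have gc : continuous g.
  move=> y; apply: cvgB; first exact: fc.
  by apply: cvgMr; exact: cvg_id.
have gE y : y \in `]a, b[ -> g y = c.
  by move=> yab; rewrite /g fE//= addrC addKr.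
have ga : g a = c.
  suff gca : g y @[y --> a^'+] --> c.
    exact: (cvg_unique _ (cvg_at_right_filter (gc a)) gca).
  apply: cvg_near_cst; near=> y; apply: gE; rewrite in_itv/=; apply/andP; split.
    by near: y; exact: nbhs_right_gt.
  by near: y; exact: nbhs_right_lt.
have gb : g b = c.
  suff gcb : g y @[y --> b^'-] --> c.
    exact: (cvg_unique _ (cvg_at_left_filter (gc b)) gcb).
  apply: cvg_near_cst; near=> y; apply: gE; rewrite in_itv/=; apply/andP; split.
    by near: y; exact: nbhs_left_gt.
  by near: y; exact: nbhs_left_lt.
have gcl y : a <= y <= b -> g y = c.
  move=> /andP[]; rewrite le_eqVlt => /predU1P[<-//|ay].
  rewrite le_eqVlt => /predU1P[->//|yb].
  by apply: gE; rewrite in_itv/= ay.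
move=> x y /gcl gx /gcl gy.
by move: gx gy; rewrite /g; lra.
Unshelve. all: by end_near. Qed.

(** A neighbourhood meets [B] in a finite, hence closed, set, from which [x]
    itself may be discarded. *)
Lemma locally_finite_punctured {R : realType} (B : set R) (x : R) :
  locally_finite_set B ->
  exists2 e : R, 0 < e & forall y, y != x -> `|x - y| < e -> ~ B y.
Proof.
move=> /(_ x)[U Ux UBfin].
have fin : finite_set ((U `&` B) `\ x) by exact: finite_setD.
have cl : closed ((U `&` B) `\ x).
  apply: (accessible_finite_set_closed.1 _ _ fin).
  exact/hausdorff_accessible/Rhausdorff.
have : nbhs x (U `&` ~` ((U `&` B) `\ x)).
  apply: filterI => //; apply: open_nbhs_nbhs; split; first exact: closed_openC.
  by case=> _; apply.
move=> /nbhs_ballP[e e0 eU]; exists e => // y yx xy By.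
have [Uy] := eU y xy; apply; split=> //.
by move=> yx'; rewrite yx' eqxx in yx.
Qed.

Lemma component_contains_itv {R : realType} {B : set R} {a b x : R} :
  a < x < b -> `]a, b[ `<=` ~` B -> `]a, b[ `<=` connected_component (~` B) x.
Proof.
move=> xab abB; apply: connected_component_max => //.
exact/connected_intervalP/interval_is_interval.
Qed.

Lemma affine_on_gap {R : realType} (phi : R -> R) (B : set R) (a b : R) :
  continuous phi -> piecewise_linear_on phi B -> a < b ->
  `]a, b[ `<=` ~` B ->
  exists2 m, slope_values phi B m & affine_on phi a b m.
Proof.
move=> phic [_ phiB] ab abB.
have xab : a < (a + b) / 2 < b by rewrite !midf_lt.
have BC : pieces B (connected_component (~` B) ((a + b) / 2)).
  by exists ((a + b) / 2) => //; apply: abB.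
have [m [c mc]] := phiB _ BC; exists m.
  by exists (connected_component (~` B) ((a + b) / 2)) => //; exists c.
apply: affine_on_open => //; exists c => y /(component_contains_itv xab abB).
exact: mc.
Qed.

Lemma slope_value_attained {R : realType} (phi : R -> R) (B : set R) (m : R) :
  continuous phi -> piecewise_linear_on phi B -> slope_values phi B m ->
  exists a b, a < b /\ affine_on phi a b m.
Proof.
move=> phic [Bfin _] [C [x Bx ->] [c mc]].
have [e e0 eB] := locally_finite_punctured _ x Bfin.
have ab : x - e < x + e by lra.
have xab : x - e < x < x + e by lra.
exists (x - e), (x + e); split=> //; apply: affine_on_open => //.
exists c => y yab; apply: mc.
apply: (component_contains_itv xab _ _ yab) => z /= zab.
have [->//|zx] := eqVneq z x; apply: eB => //.
by move: zab; rewrite in_itv/= ltr_norml; lra.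
Qed.

Lemma affine_on_sides {R : realType} (phi : R -> R) (B : set R) (x : R) :
  continuous phi -> piecewise_linear_on phi B ->
  exists e p q, [/\ 0 < e, slope_values phi B p, slope_values phi B q,
    affine_on phi (x - e) x p & affine_on phi x (x + e) q].
Proof.
move=> phic phiB; have [Bfin _] := phiB.
have [e e0 eB] := locally_finite_punctured _ x Bfin.
have [||p pB pE] := affine_on_gap phi B (x - e) x phic phiB; first lra.
  move=> z /=; rewrite in_itv/= => zab; apply: eB; first by rewrite lt_eqF; lra.
  by rewrite ltr_norml; lra.
have [||q qB qE] := affine_on_gap phi B x (x + e) phic phiB; first lra.
  move=> z /=; rewrite in_itv/= => zab; apply: eB; first by rewrite gt_eqF; lra.
  by rewrite ltr_norml; lra.
by exists e, p, q.
Qed.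

(** By superadditivity, a step [h] to the right from any point raises [phi] by
    at least [phi h], and a step to the left lowers it by at most
    [- phi (- h)]. *)
Lemma slope_bounds {R : realType} (phi : R -> R) (e p q a b m : R) :
  superadditive phi -> phi 0 = 0 -> 0 < e ->
  affine_on phi (- e) 0 p -> affine_on phi 0 e q ->
  a < b -> affine_on phi a b m -> q <= m <= p.
Proof.
move=> phiD phi0 e0 pE qE ab mE.
have [h [h0 he hab]] : exists h, [/\ 0 < h, h <= e & a + h <= b].
  exists (Num.min e (b - a)); split.
  - by rewrite lt_min e0 subr_gt0.
  - by rewrite ge_min lexx.
  - by rewrite -lerBrDl ge_min lexx orbT.
have qh := qE 0 h; have ph := pE 0 (- h).
have ma := mE a (a + h); have mb := mE b (b - h).
have := phiD a h; have := phiD b (- h).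
have {}qh : phi h = q * h by rewrite -[LHS]subr0 -phi0 qh; lra.
have {}ph : phi (- h) = - (p * h) by rewrite -[LHS]subr0 -phi0 ph; lra.
have {}ma : phi (a + h) - phi a = m * h by rewrite ma; lra.
have {}mb : phi (b - h) - phi b = - (m * h) by rewrite mb; lra.
by nra.
Qed.

(** * Summands of a convex decomposition *)

(** This is what transfers an equality satisfied by [phi] to both summands, once
    they satisfy the corresponding inequalities. *)
Lemma convex_tight {R : realType} {t a1 a2 b1 b2 : R} :
  0 < t < 1 -> a1 <= b1 -> a2 <= b2 ->
  t * a1 + (1 - t) * a2 = t * b1 + (1 - t) * b2 -> a1 = b1.
Proof.
move=> /andP[t0 t1] ab1 ab2 tE.
have t2 : 0 <= (1 - t) * (b2 - a2) by rewrite mulr_ge0; lra.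
have : t * (b1 - a1) <= 0 by lra.
by rewrite pmulr_rle0//; lra.
Qed.

Lemma locally_constant_cst {R : realType} (f : R -> R) :
  (forall x, \forall y \near x, f y = f x) -> forall x y, f x = f y.
Proof.
move=> floc x y; apply: is_derive_0_is_cst => z.
apply: near_eq_is_derive (is_derive_cst (f z) z 1).
by apply: filterS (floc z) => u /esym.
Qed.

(** The core of the argument: all increments of [phi1] over short intervals
    inside a piece are the multiple [sg / s] of those of [phi], where [- sg h]
    is the value of [phi1] at [- h]; so [phi1 - (sg / s) phi] is locally
    constant. *)
Lemma summand_proportional {R : realType} (phi phi1 phi2 : R -> R) (t e s : R) :
  0 < t < 1 -> (forall x, phi x = t * phi1 x + (1 - t) * phi2 x) ->
  superadditive phi1 -> superadditive phi2 ->
  {homo phi1 : x y / x <= y} -> {homo phi2 : x y / x <= y} ->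
  phi 0 = 0 -> phi1 0 = 0 ->
  0 < e -> 0 < s -> affine_on phi (- e) 0 s ->
  (forall x, exists d p q,
    [/\ 0 < d, p = 0 \/ p = s, q = 0 \/ q = s,
        affine_on phi (x - d) x p & affine_on phi x (x + d) q]) ->
  exists k, forall x, phi1 x = k * phi x.
Proof.
move=> t01 phiE D1 D2 le1 le2 phi0 phi10 e0 s0 negE sides.
have inherit x y :
    phi x + phi y = phi (x + y) -> phi1 x + phi1 y = phi1 (x + y).
  move=> xy; apply: (convex_tight t01 (D1 x y) (D2 x y)).
  by move: xy; rewrite !phiE; lra.
have neg h : 0 <= h <= e -> phi (- h) = - (s * h).
  by move=> he; rewrite -[LHS]subr0 -phi0 negE; lra.
have [sg neg1] : exists sg, forall h, 0 <= h <= e -> phi1 (- h) = - (sg * h).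
  pose f h := - phi1 (- h); exists (f e / e) => h he.
  apply: oppr_inj; rewrite opprK.
  apply: (monotone_additive_linear f) => // [x y _ _ xy|x y x0 y0 xy].
    by rewrite /f lerN2 le1// lerN2.
  rewrite /f opprD -inherit ?opprD// -opprD !neg; lra.
pose k := sg / s.
have ks : k * s = sg by rewrite mulfVK// gt_eqF.
have step a b p x y : p = 0 \/ p = s -> affine_on phi a b p ->
    a <= x -> x <= y -> y <= b -> y - x <= e ->
    phi1 y - phi1 x = k * (phi y - phi x).
  move=> p0s pE ax xy yb xye.
  have phixy : phi y - phi x = p * (y - x) by apply: pE; lra.
  case: p0s phixy => -> phixy.
    have <- : phi1 x = phi1 y.
      apply: (convex_tight t01 (le1 _ _ xy) (le2 _ _ xy)).
      by rewrite -!phiE; lra.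
    by rewrite phixy mul0r mulr0 subrr.
  (* On a piece of slope [s], [phi x = phi y + phi (- (y - x))]. *)
  have xyh : 0 <= y - x <= e by rewrite subr_ge0 xy.
  have := inherit y (- (y - x)).
  rewrite subKr neg// neg1// phixy mulrA ks; lra.
exists k => x.
suff cst : phi1 x - k * phi x = phi1 0 - k * phi 0.
  by move: cst; rewrite phi10 phi0 mulr0 subr0 => /subr0_eq.
apply: (locally_constant_cst (fun z => phi1 z - k * phi z)) => z.
have [d [p [q [d0 p0 q0 pE qE]]]] := sides z.
have m0 : 0 < Num.min d e by rewrite lt_min d0.
near=> y.
have : `|z - y| < Num.min d e by near: y; exact: nbhsx_ballx.
rewrite lt_min !ltr_norml => /andP[yd ye].
have [yz|/ltW zy] := leP y z.
  by have := step _ _ _ y z p0 pE; lra.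
by have := step _ _ _ z y q0 qE; lra.
Unshelve. all: by end_near. Qed.

Theorem theorem11 (R : realType) (phi : R -> R) (B : set R) (s1 s2 : R)
    (phi_continuous : continuous phi)
    (phi_pwl : piecewise_linear_on phi B)
    (phi_strongly_maximal : strongly_maximal phi)
    (s1_neq_s2 : s1 <> s2)
    (phi_two_slopes : slope_values phi B = [set s1; s2]) :
  extreme phi.
Proof.
have phi_max := strongly_maximal_undominated phi_strongly_maximal.
have phi_at1 := strongly_maximal_at1 phi_strongly_maximal.
have [phiD phi_le phi0] := undominated_shape phi_max.
have [e [p [q [e0 pB qB]]]] := affine_on_sides phi B 0 phi_continuous phi_pwl.
rewrite sub0r add0r => pE qE.
have between m : slope_values phi B m -> q <= m <= p.
  move=> /slope_value_attained[//|//|a [b [ab mE]]].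
  exact: slope_bounds e0 pE qE ab mE.
have q0 : q = 0.
  have q_ge0 : 0 <= q.
    have := phi_le _ _ (ltW e0); have := qE 0 e; rewrite lexx (ltW e0) lexx.
    by move=> /(_ isT isT); rewrite phi0 !subr0 => ->; rewrite pmulr_lge0.
  (* Otherwise superadditivity spreads [phi h = q h] from small [h] to a lower
     bound [q h] for all [h >= 0]. *)
  apply: contrapT => /eqP q0; have q_gt0 : 0 < q by rewrite lt_neqAle eq_sym q0.
  apply: (strongly_maximal_no_linear_minorant phi_strongly_maximal q_gt0).
  move=> h h0.
  have := truncn_itv (divr_ge0 h0 (ltW e0)).
  set N := _.+1%:R => /andP[_ hN]; have N0 : 0 < N by rewrite ltr0n.
  have uE : phi (h / N) = q * (h / N).
    rewrite -[LHS]subr0 -phi0 qE ?subr0 ?lexx ?(ltW e0) ?divr_ge0 ?(ltW N0)//=.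
    by rewrite ler_pdivrMr// mulrC -ler_pdivrMr// ltW.
  have := superadditive_natmul phi (Num.truncn (h / e)).+1 (h / N) phiD phi0.
  by rewrite -/N uE mulrCA [N * _]mulrC divfK// gt_eqF.
have p0 : 0 < p.
  move: (between s1) (between s2); rewrite phi_two_slopes q0 /=.
  move=> /(_ (or_introl erefl)) b1 /(_ (or_intror erefl)) b2.
  by rewrite ltNge; apply/negP => p0; apply: s1_neq_s2; lra.
have slopes m : slope_values phi B m -> m = 0 \/ m = p.
  move: pB qB; rewrite phi_two_slopes q0 /=.
  by move=> [ps|ps] [qs|qs] [->|->]; first [lra | left; lra | right; lra].
split; first by case: phi_max.
move=> [f1 [f2 [t [[G1 G2] [n1 n2 _] /andP[t0 t1] phiE]]]].
have t01 : 0 < t < 1.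
  rewrite !lt_neqAle t0 t1 !andbT; apply/andP; split; apply/eqP => tE.
    by apply: n2; apply/funext => x; rewrite phiE -tE mul0r add0r subr0 mul1r.
  by apply: n1; apply/funext => x; rewrite phiE tE mul1r subrr mul0r addr0.
have t'01 : 0 < 1 - t < 1 by lra.
have [D1 le1 f10] :=
  undominated_shape (undominated_summand phi_max G1 G2 t01 phiE).
have phiE' x : phi x = (1 - t) * f2 x + (1 - (1 - t)) * f1 x.
  by rewrite phiE; lra.
have [D2 le2 _] :=
  undominated_shape (undominated_summand phi_max G2 G1 t'01 phiE').
have [k kE] : exists k, forall x, f1 x = k * phi x.
  apply: (summand_proportional phi f1 f2 t e p) => // x.
  have [d [p' [q' [d0 p'B q'B p'E q'E]]]] :=
    affine_on_sides phi B x phi_continuous phi_pwl.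
  by exists d, p', q'; split=> //; apply: slopes.
have f11 : f1 1 = 1.
  apply: (convex_tight t01 (gDFF_at1 G1) (gDFF_at1 G2)).
  by rewrite -phiE phi_at1; lra.
apply: n1; apply/funext => x.
by move: (kE 1); rewrite f11 phi_at1 mulr1 kE => <-; rewrite mul1r.
Qed.
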